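(* Let $\langle\mathbb{X},\mathbb{0},\mathbb{1},\oplus,\otimes\rangle$ be a linearly ordered idempotent semifield. Let $\bm{A}=(a_{ij})\in\mathbb{X}^{m\times n}$ be a matrix all of whose columns are regular, with columns $\bm{a}_1,\ldots,\bm{a}_n$; let $\bm{B}\in\mathbb{X}^{l\times n}$ be a column regular matrix with columns $\bm{b}_1,\ldots,\bm{b}_n$; and let $\bm{p}=(p_i)\in\mathbb{X}^{m}$ and $\bm{q}\in\mathbb{X}^{l}$ be regular vectors. Define the scalar $$\Delta=\bm{q}^{-}\bm{B}\bm{A}^{-}\bm{p}.$$ Consider the problem of maximizing $$\bm{q}^{-}\bm{B}\bm{x}(\bm{A}\bm{x})^{-}\bm{p}$$ over all regular vectors $\bm{x}=(x_i)\in\mathbb{X}^{n}$. Then the maximum is equal to $\Delta$, and a regular vector $\bm{x}$ attains it if and only if there exist a scalar $\alpha>\mathbb{0}$, an index $k\in\{1,\ldots,n\}$ at which $\bm{q}^{-}\bm{b}_{i}\bm{a}_{i}^{-}\bm{p}$ is maximal over $1\leq i\leq n$, and an index $s\in\{1,\ldots,m\}$ at which $a_{ik}^{-1}p_{i}$ is maximal over $1\leq i\leq m$, such that $$x_{k}=\alpha\,\bm{a}_{k}^{-}\bm{p},\qquad x_{j}\leq\alpha\, a_{sj}^{-1}p_{s}\quad\text{for all } j\ne k.$$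
   Context: Idempotent semifield: $\mathbb{X}$ is a set with associative and commutative operations $\oplus$ (addition, neutral element $\mathbb{0}$) and $\otimes$ (multiplication, neutral element $\mathbb{1}$; the sign $\otimes$ is omitted), multiplication distributes over addition, $x\oplus x=x$ for all $x$, and every $x\neq\mathbb{0}$ has a multiplicative inverse $x^{-1}$. The order is given by $x\leq y$ iff $x\oplus y=y$; it is assumed to be total (linearly ordered semifield), and all inequalities and maxima refer to this order. Matrix and vector operations follow the usual rules with $\oplus,\otimes$ in place of ordinary addition and multiplication. Vectors are column vectors. A vector is regular if none of its components is $\mathbb{0}$. ''All columns of $\bm{A}$ are regular'' means that $\bm{A}$ has no entry equal to $\mathbb{0}$. A matrix is column regular if no column consists entirely of $\mathbb{0}$. For a regular vector $\bm{x}=(x_i)$, $\bm{x}^{-}$ is the row vector with components $x_i^{-1}$. For a matrix $\bm{A}=(a_{ij})\in\mathbb{X}^{m\times n}$ with all columns regular, $\bm{A}^{-}\in\mathbb{X}^{n\times m}$ is the matrix whose $(i,j)$ entry is $a_{ji}^{-1}$. *)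

(* Defs.v *)
From HB Require Import structures.
From mathcomp Require Import all_boot all_order all_algebra.

Set Implicit Arguments.
Unset Strict Implicit.
Unset Printing Implicit Defensive.

Import Order.TTheory GRing.Theory.

Local Open Scope ring_scope.

(* The semifield addition, multiplication, zero and one are the semiring      *)
(* operations +, *, 0, 1 of ring_scope, so that *m is the matrix product over *)
(* the idempotent semifield.  Absorption by 0, part of comPzSemiRingType,     *)
(* follows from the other axioms of an idempotent semifield.                  *)
(* [sfinv 0] is left unspecified.                                             *)
HB.mixin Record ComPzSemiRing_isIdemSemifield X of GRing.ComPzSemiRing X := {
  sfinv : X -> X;
  sfaddxx : forall x : X, x + x = x;
  sfmulxV : forall x : X, x != 0 -> x * sfinv x = 1
}.

#[short(type="idemSemifieldType")]
HB.structure Definition IdemSemifield :=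
  {X of GRing.ComPzSemiRing X & ComPzSemiRing_isIdemSemifield X}.

HB.mixin Record IdemSemifield_isLinear X of IdemSemifield X := {
  sftotal : forall x y : X, (x + y == y) || (y + x == x)
}.

#[short(type="linSemifieldType")]
HB.structure Definition LinSemifield :=
  {X of IdemSemifield X & IdemSemifield_isLinear X}.

Fact sf_display : Order.disp_t. Proof. exact: Order.Disp tt tt. Qed.

(* The order notations in %O on a linSemifieldType refer to [sfle].           *)
Section LinOrder.
Variable X : linSemifieldType.
Implicit Types x y z : X.

Definition sfle x y : bool := x + y == y.

Fact sfle_refl : reflexive sfle.
Proof. by move=> x; rewrite /sfle sfaddxx. Qed.

Fact sfle_anti : antisymmetric sfle.
Proof. by move=> x y /andP[/eqP xy /eqP yx]; rewrite -xy addrC. Qed.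

Fact sfle_trans : transitive sfle.
Proof. by move=> y x z /eqP xy /eqP yz; rewrite /sfle -yz addrA xy. Qed.

Fact sfle_total : total sfle.
Proof. exact: sftotal. Qed.

HB.instance Definition _ :=
  Order.Le_isPOrder.Build sf_display (LinSemifield.sort X)
    sfle_refl sfle_anti sfle_trans.
HB.instance Definition _ :=
  Order.POrder_isTotal.Build sf_display (LinSemifield.sort X) sfle_total.

Lemma sfleE x y : (x <= y)%O = (x + y == y).
Proof. by []. Qed.

End LinOrder.

Section Matrices.
Variable X : idemSemifieldType.

Definition regular m (v : 'cV[X]_m) : Prop := forall i, v i 0 != 0.

Definition col_regular m n (A : 'M[X]_(m, n)) : Prop :=
  forall j, col j A != 0.

(* Multiplicative conjugate transpose, the matrix written with superscript    *)
(* minus; only meaningful when A has no zero entry.  On a column vector it is *)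
(* the row vector of the inverses.                                            *)
Definition mconj m n (A : 'M[X]_(m, n)) : 'M[X]_(n, m) :=
  \matrix_(i, j) sfinv (A j i).

End Matrices.

(* Main.v *)
(* Write w = q^- B, y = A x and g = y^- p, so that the objective is the        *)
(* maximum over j of w_j x_j g, and Delta is the maximum over j of            *)
(* w_j (a_j^- p).  Since y_i >= a_ij x_j, we have x_j g <= a_j^- p for all j, *)
(* whence the bound.  Equality forces x_k g = a_k^- p at an index k attaining *)
(* the first maximum; if g = y_s^-1 p_s, then a_sk x_k = y_s, i.e. column k   *)
(* dominates row s of A x, and this is the stated description of x with       *)
(* alpha = x_k (a_k^- p)^-1.                                                  *)
Require Import Defs.
From HB Require Import structures.
From mathcomp Require Import all_boot all_order all_algebra.

Set Implicit Arguments.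
Unset Strict Implicit.
Unset Printing Implicit Defensive.

Import Order.TTheory GRing.Theory.

Local Open Scope ring_scope.

(** The objective and [Delta] are sums over j with the same weights w_j ([ratioE], [col_ratioE]), so
    it suffices to compare x_j g with a_j^- p for each j. [mul_conj_le] is the inequality;
    [conj_mul_eq] and [conj_mul_eq_inv] describe equality at an index k: up to a scalar, x lies
    below the vector of the a_sj^-1 p_s and meets it at k, where s maximizes a_ik^-1 p_i. Since the
    order is total, a nonempty sum equals one of its terms ([sfsum_max]), so attaining [Delta]
    amounts to equality at a single maximal k. *)

Section SemifieldOrder.
Variable X : linSemifieldType.
Implicit Types x y z : X.

Lemma sf_ge0 x : ((0 : X) <= x)%O.
Proof. by rewrite sfleE add0r. Qed.

Lemma sf_gt0 x : ((0 : X) < x)%O = (x != 0).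
Proof. by rewrite lt_def sf_ge0 andbT. Qed.

Lemma sfmulVx x : x != 0 -> sfinv x * x = 1.
Proof. by move=> x0; rewrite mulrC sfmulxV. Qed.

Lemma sfmulKx x y : x != 0 -> sfinv x * (x * y) = y.
Proof. by move=> x0; rewrite mulrA sfmulVx ?mul1r. Qed.

Lemma sfmulVKx x y : x != 0 -> x * (sfinv x * y) = y.
Proof. by move=> x0; rewrite mulrA sfmulxV ?mul1r. Qed.

Lemma sfinv_neq0 x : x != 0 -> sfinv x != 0.
Proof.
(* A zero inverse would give 1 = 0 and hence x = 0; [1 != 0] is not among the axioms. *)
move=> x0; apply: contra_neq (x0) => Vx0.
by rewrite -[x]mulr1 -(sfmulxV _ x0) Vx0 !mulr0.
Qed.

Lemma sfmul_neq0 x y : x != 0 -> y != 0 -> x * y != 0.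
Proof.
by move=> x0; apply: contra_neq => xy0; rewrite -(sfmulKx y x0) xy0 mulr0.
Qed.

Lemma sfle_mull z x y : (x <= y)%O -> (z * x <= z * y)%O.
Proof. by rewrite !sfleE -mulrDr => /eqP->. Qed.

Lemma sfle_mul2l z x y : z != 0 -> (z * x <= z * y)%O = (x <= y)%O.
Proof.
move=> z0; apply/idP/idP; last exact: sfle_mull.
by move=> /(sfle_mull (sfinv z)); rewrite !sfmulKx.
Qed.

Lemma sfle_mul2r z x y : z != 0 -> (x * z <= y * z)%O = (x <= y)%O.
Proof. by move=> z0; rewrite ![_ * z]mulrC sfle_mul2l. Qed.

Lemma sfmul_inj z x y : z != 0 -> z * x = z * y -> x = y.
Proof. by move=> z0 E; rewrite -(sfmulKx x z0) E sfmulKx. Qed.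

Lemma sfle_divl z x y : z != 0 -> (sfinv z * x <= y)%O = (x <= z * y)%O.
Proof. by move=> z0; rewrite -(sfle_mul2l _ _ z0) sfmulVKx. Qed.

Lemma sfle_divr z x y : z != 0 -> (x <= sfinv z * y)%O = (z * x <= y)%O.
Proof. by move=> z0; rewrite -(sfle_mul2l _ _ z0) sfmulVKx. Qed.

Lemma sfle_sum (I : finType) (F : I -> X) i : (F i <= \sum_j F j)%O.
Proof. by rewrite (bigD1 i) //= sfleE addrA sfaddxx. Qed.

Lemma sfsum_le (I : finType) (F : I -> X) y :
  (forall i, (F i <= y)%O) -> (\sum_i F i <= y)%O.
Proof.
move=> Fy; elim/big_rec: _ => [|i x _ xy]; first exact: sf_ge0.
by rewrite sfleE -addrA (eqP xy) -sfleE.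
Qed.

Lemma sfsum_max (I : finType) (i0 : I) (F : I -> X) :
  exists i, \sum_j F j = F i.
Proof.
case: (@arg_maxP _ _ _ i0 xpredT F isT) => i _ Fi; exists i.
by apply: le_anti; rewrite sfle_sum sfsum_le // => j; apply: Fi.
Qed.

End SemifieldOrder.

Section Ratio.
Variables (X : linSemifieldType) (m n : nat) (A : 'M[X]_(m, n)) (p : 'cV[X]_m).
Hypothesis A_neq0 : forall i j, A i j != 0.
Implicit Types (x : 'cV[X]_n) (w : 'rV[X]_n).

Lemma mconj_mulE k (C : 'M[X]_(m, k)) j :
  (mconj C *m p) j 0 = \sum_i sfinv (C i j) * p i 0.
Proof. by rewrite mxE; apply: eq_bigr => i _; rewrite mxE. Qed.

Lemma col_ratioE w j :
  (col j w *m mconj (col j A) *m p) 0 0 = w 0 j * (mconj A *m p) j 0.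
Proof.
rewrite -mulmxA [LHS]mxE big_ord1 !mconj_mulE mxE.
by congr (_ * _); apply: eq_bigr => i _; rewrite mxE.
Qed.

Lemma ratioE w x :
  (w *m x *m mconj (A *m x) *m p) 0 0 =
  \sum_j w 0 j * (x j 0 * (mconj (A *m x) *m p) 0 0).
Proof.
rewrite -mulmxA [LHS]mxE big_ord1 mxE mulr_suml.
by apply: eq_bigr => j _; rewrite mulrA.
Qed.

Lemma mulmx_ge x i j : (A i j * x j 0 <= (A *m x) i 0)%O.
Proof. by rewrite mxE; apply: (sfle_sum (fun j => A i j * x j 0)). Qed.

Lemma mulmx_regular x : (0 < n)%N -> regular x -> regular (A *m x).
Proof.
move=> n_gt0 x0 i; rewrite -sf_gt0.
apply: lt_le_trans (mulmx_ge x i (Ordinal n_gt0)).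
by rewrite sf_gt0 sfmul_neq0.
Qed.

(** From a_ij x_j <= (A x)_i one gets x_j (A x)_i^-1 p_i <= a_ij^-1 p_i; sum over i. *)
Lemma mul_conj_le x j : regular x ->
  (x j 0 * (mconj (A *m x) *m p) 0 0 <= (mconj A *m p) j 0)%O.
Proof.
move=> x0; have n_gt0 : (0 < n)%N by apply: leq_ltn_trans (ltn_ord j).
rewrite !mconj_mulE mulr_sumr; apply: sfsum_le => i.
apply: le_trans (sfle_sum (fun i => sfinv (A i j) * p i 0) i).
rewrite sfle_divr // mulrA mulrCA sfle_divl; last exact: mulmx_regular.
by rewrite ![_ * p i 0]mulrC sfle_mull ?mulmx_ge.
Qed.

Lemma ratio_le w x : regular x ->
  ((w *m x *m mconj (A *m x) *m p) 0 0 <= (w *m mconj A *m p) 0 0)%O.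
Proof.
move=> x0; rewrite ratioE -[w *m _ *m p]mulmxA [leRHS]mxE.
apply: sfsum_le => j; apply: le_trans (sfle_sum _ j).
exact/sfle_mull/mul_conj_le.
Qed.

Hypotheses (m_gt0 : (0 < m)%N) (p_neq0 : regular p).

(** The bounds on x keep row s of A x below alpha p_s, so alpha g >= 1 for g = (A x)^- p, and x_k g
    = (a_k^- p)(alpha g) >= a_k^- p. *)
Lemma conj_mul_eq (alpha : X) x k s : alpha != 0 -> regular x ->
    (forall i, (sfinv (A i k) * p i 0 <= sfinv (A s k) * p s 0)%O) ->
    x k 0 = alpha * (mconj A *m p) k 0 ->
    (forall j, j != k -> (x j 0 <= alpha * (sfinv (A s j) * p s 0))%O) ->
  x k 0 * (mconj (A *m x) *m p) 0 0 = (mconj A *m p) k 0.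
Proof.
move=> a0 x0 smax xk xj; apply: le_anti; rewrite mul_conj_le //=.
have gk : (mconj A *m p) k 0 = sfinv (A s k) * p s 0.
  apply: le_anti; rewrite mconj_mulE sfsum_le //=.
  exact: (sfle_sum (fun i => sfinv (A i k) * p i 0)).
have n_gt0 : (0 < n)%N by apply: leq_ltn_trans (ltn_ord k).
have Axs : ((A *m x) s 0 <= alpha * p s 0)%O.
  rewrite mxE; apply: sfsum_le => j.
  rewrite -sfle_divr // mulrCA.
  by have [->|/xj//] := eqVneq j k; rewrite xk gk.
rewrite xk -mulrA mulrCA -[leLHS]mulr1; apply: sfle_mull.
rewrite mconj_mulE mulr_sumr; apply: le_trans (sfle_sum _ s); rewrite mulrCA.
by rewrite sfle_divr ?mulr1 //; apply: mulmx_regular.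
Qed.

Lemma conj_mul_eq_inv x k : regular x ->
    x k 0 * (mconj (A *m x) *m p) 0 0 = (mconj A *m p) k 0 ->
  exists (alpha : X) (s : 'I_m),
    [/\ alpha != 0,
        forall i, (sfinv (A i k) * p i 0 <= sfinv (A s k) * p s 0)%O,
        x k 0 = alpha * (mconj A *m p) k 0
      & forall j, (x j 0 <= alpha * (sfinv (A s j) * p s 0))%O].
Proof.
move=> x0 xg; have n_gt0 : (0 < n)%N by apply: leq_ltn_trans (ltn_ord k).
have Ax0 := mulmx_regular n_gt0 x0.
have le_gk i : (sfinv (A i k) * p i 0 <= (mconj A *m p) k 0)%O.
  by rewrite mconj_mulE; apply: (sfle_sum (fun i => sfinv (A i k) * p i 0)).
(* Here s maximizes (A x)_i^-1 p_i; the equality [xg] will make it maximize a_ik^-1 p_i as well. *)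
have [s gs] := sfsum_max (Ordinal m_gt0)
  (fun i => sfinv ((A *m x) i 0) * p i 0).
rewrite -mconj_mulE in gs; rewrite gs in xg.
(* Cancel p_s in a_sk^-1 p_s <= a_k^- p = x_k (A x)_s^-1 p_s. *)
have Axs : (A *m x) s 0 = A s k * x k 0.
  apply: le_anti; rewrite mulmx_ge andbT.
  have := le_gk s; rewrite -xg sfle_divl // mulrA mulrCA sfle_divr //.
  by rewrite sfle_mul2r.
have gk : (mconj A *m p) k 0 = sfinv (A s k) * p s 0.
  rewrite -xg; apply: (sfmul_inj (A_neq0 s k)).
  by rewrite mulrA -Axs !sfmulVKx.
have gk0 : sfinv (A s k) * p s 0 != 0.
  by rewrite sfmul_neq0 ?sfinv_neq0.
exists (x k 0 * sfinv ((mconj A *m p) k 0)), s; rewrite gk; split.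
- by rewrite sfmul_neq0 ?sfinv_neq0.
- by move=> i; rewrite -gk.
- by rewrite -mulrA sfmulVx ?mulr1.
(* a_sj x_j <= (A x)_s = a_sk x_k = alpha p_s. *)
- move=> j; rewrite mulrCA sfle_divr //.
  apply: le_trans (mulmx_ge x s j) _.
  by rewrite Axs mulrC -mulrA -{2}(sfmulVKx (p s 0) (A_neq0 s k))
    [sfinv (_ * _) * _]mulrCA sfmulVx ?mulr1.
Qed.

End Ratio.

Theorem theorem3 (X : linSemifieldType) (l m n : nat)
    (l_gt0 : (0 < l)%N) (m_gt0 : (0 < m)%N) (n_gt0 : (0 < n)%N)
    (A : 'M[X]_(m, n)) (B : 'M[X]_(l, n)) (p : 'cV[X]_m) (q : 'cV[X]_l)
    (regA : forall j, regular (col j A)) (regB : col_regular B)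
    (regp : regular p) (regq : regular q) :
  let Delta : X := (mconj q *m B *m mconj A *m p) 0 0 in
  let f (x : 'cV[X]_n) : X := (mconj q *m B *m x *m mconj (A *m x) *m p) 0 0 in
  let c (i : 'I_n) : X := (mconj q *m col i B *m mconj (col i A) *m p) 0 0 in
  [/\ exists2 x : 'cV[X]_n, regular x & f x = Delta,
      forall x : 'cV[X]_n, regular x -> (f x <= Delta)%O
    & forall x : 'cV[X]_n, regular x ->
      (f x = Delta <->
       exists (alpha : X) (k : 'I_n) (s : 'I_m),
         [/\ ((0 : X) < alpha)%O,
             forall i, (c i <= c k)%O,
             forall i, (sfinv (A i k) * p i 0 <= sfinv (A s k) * p s 0)%O,
             x k 0 = alpha * (mconj (col k A) *m p) 0 0
           & forall j, j != k ->
               (x j 0 <= alpha * (sfinv (A s j) * p s 0))%O])].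
Proof.
move=> Delta f c.
have A0 i j : A i j != 0 by have := regA j i; rewrite mxE.
pose w := mconj q *m B.
(* Nonzero weights allow w_k to be cancelled in the necessity part. *)
have w0 j : w 0 j != 0.
  have /cV0Pn[i] := regB j; rewrite mxE => Bij.
  rewrite -sf_gt0 mxE.
  apply: lt_le_trans (sfle_sum (fun i => mconj q 0 i * B i j) i).
  by rewrite sf_gt0 mxE sfmul_neq0 ?sfinv_neq0.
have cE j : c j = w 0 j * (mconj A *m p) j 0.
  by rewrite /c colE mulmxA -colE col_ratioE.
have DeltaE : Delta = \sum_j c j.
  by rewrite /Delta -mulmxA [LHS]mxE; apply: eq_bigr => j _; rewrite cE.
have c_le j : (c j <= Delta)%O by rewrite DeltaE sfle_sum.
have fE x : f x = \sum_j w 0 j * (x j 0 * (mconj (A *m x) *m p) 0 0).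
  exact: ratioE.
have f_le x : regular x -> (f x <= Delta)%O by move=> x0; apply: ratio_le.
have conj_colE k : (mconj (col k A) *m p) 0 0 = (mconj A *m p) k 0.
  by rewrite !mconj_mulE; apply: eq_bigr => i _; rewrite mxE.
have sufficient x alpha k s : regular x -> alpha != 0 ->
    (forall i, (c i <= c k)%O) ->
    (forall i, (sfinv (A i k) * p i 0 <= sfinv (A s k) * p s 0)%O) ->
    x k 0 = alpha * (mconj A *m p) k 0 ->
    (forall j, j != k -> (x j 0 <= alpha * (sfinv (A s j) * p s 0))%O) ->
    f x = Delta.
  move=> x0 a0 kmax smax xk xj; apply: le_anti; rewrite f_le //=.
  rewrite DeltaE fE; apply: le_trans (sfsum_le kmax) _.
  rewrite cE -(conj_mul_eq A0 a0 x0 smax xk xj).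
  exact: (sfle_sum (fun j => w 0 j * (x j 0 * _))).
split=> [|//|x x0].
- have [k ck] := sfsum_max (Ordinal n_gt0) c.
  have [s gs] := sfsum_max (Ordinal m_gt0) (fun i => sfinv (A i k) * p i 0).
  have nz1 : (1 : X) != 0.
    by apply: contra_neq (regp s) => E; rewrite -[LHS]mulr1 E mulr0.
  (* The maximizer takes alpha = 1 and equality in every bound. *)
  pose x : 'cV[X]_n := \col_j (sfinv (A s j) * p s 0).
  have x0 : regular x by move=> j; rewrite mxE sfmul_neq0 ?sfinv_neq0.
  exists x => //; apply: (sufficient x 1 k s) => //.
  + by move=> i; rewrite -ck sfle_sum.
  + by move=> i; rewrite -gs; apply: (sfle_sum (fun i => sfinv (A i k) * _)).
  + by rewrite mul1r mconj_mulE gs mxE.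
  + by move=> j _; rewrite mul1r mxE.
- split=> [fx|[alpha [k [s [a0 kmax smax xk xj]]]]]; last first.
    by apply: (sufficient x alpha k s); rewrite // -?sf_gt0 -?conj_colE.
  (* For k attaining the sum f x, [Delta] = w_k x_k g <= c_k <= [Delta]: this yields both equality
     at k and maximality of c_k. *)
  have [k fk] := sfsum_max (Ordinal n_gt0)
    (fun j => w 0 j * (x j 0 * (mconj (A *m x) *m p) 0 0)).
  rewrite -fE fx in fk.
  have xg : x k 0 * (mconj (A *m x) *m p) 0 0 = (mconj A *m p) k 0.
    apply: le_anti; rewrite mul_conj_le //= -(sfle_mul2l _ _ (w0 k)).
    by rewrite -cE -fk.
  have [alpha [s [a0 smax xk xj]]] := conj_mul_eq_inv A0 m_gt0 regp x0 xg.
  exists alpha, k, s; split; rewrite ?sf_gt0 ?conj_colE //.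
  by move=> i; rewrite (cE k) -xg -fk.
Qed.
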